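(* Let $Y$ and $\psi$ be real-valued random variables with cumulative distribution functions $F_Y$ and $F_\psi$, and suppose that $\mathbb{E}(|Y|)<\infty$ and $\mathbb{E}(|\psi|)<\infty$. For $y\in\mathbb{R}$ let $\Delta(y)=\int_{-\infty}^{y}\left(F_Y(t)-F_\psi(t)\right)dt$. Then the following statements are equivalent: (i) $\mathrm{H}_0$ holds, i.e., there exist a pair of random variables $(Y',\psi')$ and a sigma-algebra $\mathcal{I}'$ such that $\sigma(\psi')\subset\mathcal{I}'$, $Y'\sim Y$, $\psi'\sim\psi$ and $\mathbb{E}[Y'|\mathcal{I}']=\psi'$; (ii) $\Delta(y)\geq 0$ for all $y\in\mathbb{R}$ and $\mathbb{E}[Y]=\mathbb{E}[\psi]$ (that is, $F_Y$ is a mean-preserving spread of $F_\psi$); (iii) $\mathbb{E}\left[(y-Y)^+-(y-\psi)^+\right]\geq 0$ for all $y\in\mathbb{R}$ and $\mathbb{E}[Y]=\mathbb{E}[\psi]$.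
   Context: $\sim$ denotes equality in distribution, $x^+=\max(0,x)$, and $\sigma(\psi')$ is the sigma-algebra generated by $\psi'$. The pair $(Y',\psi')$ may be defined on any probability space, with $\mathcal{I}'$ a sub-sigma-algebra of that space; only the marginal distributions of $Y$ and $\psi$ matter. *)

(* Defs.v *)
From HB Require Import structures.
From mathcomp Require Import all_boot all_order all_algebra.
From mathcomp Require Import all_classical all_reals all_analysis.

Set Implicit Arguments.
Unset Strict Implicit.
Unset Printing Implicit Defensive.

Import Order.TTheory GRing.Theory Num.Theory.
Import numFieldNormedType.Exports.

Local Open Scope classical_set_scope.
Local Open Scope ring_scope.

(* The comparison is over measurable sets only: the value of a measure at a
   non-measurable set is unspecified. *)
Definition eq_in_distribution (R : realType)
    (d1 : measure_display) (T1 : measurableType d1) (P1 : probability T1 R)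
    (d2 : measure_display) (T2 : measurableType d2) (P2 : probability T2 R)
    (X1 : {RV P1 >-> R}) (X2 : {RV P2 >-> R}) : Prop :=
  forall A : set R, measurable A -> distribution P1 X1 A = distribution P2 X2 A.

Definition sub_sigma_algebra_of (d : measure_display) (T : measurableType d)
    (G : set_system T) : Prop :=
  sigma_algebra [set: T] G /\ G `<=` measurable.

(* Kolmogorov's definition: [Z] is a version of E[X | G].  The conditional
   expectation is unique only up to almost sure equality, hence a relation. *)
Definition is_cond_expectation (R : realType) (d : measure_display)
    (T : measurableType d) (P : probability T R) (G : set_system T)
    (X Z : {RV P >-> R}) : Prop :=
  [/\ P.-integrable [set: T] (EFin \o X),
      P.-integrable [set: T] (EFin \o Z),
      g_sigma_algebra_preimage Z `<=` G &
      forall A : set T, G A ->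
        (\int[P]_(w in A) (Z w)%:E = \int[P]_(w in A) (X w)%:E)%E].

(* The space carrying (Y', psi') is existentially quantified and unrelated to
   the one carrying (Y, psi). *)
Definition H0 (R : realType) (d : measure_display) (T : measurableType d)
    (P : probability T R) (Y psi : {RV P >-> R}) : Prop :=
  exists (d' : measure_display) (T' : measurableType d')
    (P' : probability T' R) (Y' psi' : {RV P' >-> R}) (I' : set_system T'),
    [/\ sub_sigma_algebra_of I',
        g_sigma_algebra_preimage psi' `<=` I',
        eq_in_distribution Y' Y,
        eq_in_distribution psi' psi &
        is_cond_expectation I' Y' psi'].

(* An extended real, since [cdf] is [\bar R]-valued; when Y and psi are
   integrable so is the integrand, and [Delta] is finite. *)
Definition Delta (R : realType) (d : measure_display) (T : measurableType d)
    (P : probability T R) (Y psi : {RV P >-> R}) (y : R) : \bar R :=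
  (\int[lebesgue_measure]_(t in `]-oo, y]) (cdf Y t - cdf psi t))%E.

Definition pos_part (R : realType) (x : R) : R := Num.max 0 x.

(* Main.v *)
(* The implications (i) => (iii) <=> (ii) are Jensen's inequality on the event
   [psi' < y] and Tonelli's identity int_{-oo}^y F_Y = E[(y - Y)^+].

   For (iii) => (i) (Strassen's theorem on the line), let [a], [b] be the quantile
   functions of psi and Y on (0, 1), so that int_0^x b <= int_0^x a, with equality
   at x = 1.  The measures (a - b)^+ du and (b - a)^+ du then have the same mass M,
   and their quantile functions U, V on (0, M) satisfy U <= V; moreover
   b(U) < a(U) <= a(V) < b(V) almost everywhere.  Exchange mass between U(s) and
   V(s) at the same rate ds / (b(V) - b(U)) in both directions, leaving all other
   mass in place: this symmetric coupling of the Lebesgue measure with itself,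
   pushed forward by (a, b), is a martingale coupling of psi and Y. *)
Require Import Defs.
From HB Require Import structures.
From mathcomp Require Import all_boot all_order all_algebra.
From mathcomp Require Import all_classical all_reals all_analysis.
From mathcomp Require Import measurable_realfun ring lra.

Import Order.TTheory GRing.Theory Num.Theory.
Import numFieldNormedType.Exports.

Local Open Scope classical_set_scope.
Local Open Scope ring_scope.

(** * Measures given by densities *)

Section density_measure.
Local Open Scope ereal_scope.
Context (d : measure_display) (T : measurableType d) (R : realType).
Variables (mu : {measure set T -> \bar R}) (f : T -> R).
Hypotheses (mf : measurable_fun [set: T] f) (f0 : forall x, (0 <= f x)%R).

Let dens (A : set T) := \int[mu]_(x in A) (f x)%:E.

Let dens0 : dens set0 = 0.
Proof. exact: integral_set0. Qed.

Let dens_ge0 A : 0 <= dens A.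
Proof. by apply: integral_ge0 => x _; rewrite lee_fin. Qed.

Let dens_sigma_additive : semi_sigma_additive dens.
Proof.
move=> /= A mA tA mUA; rewrite /dens ge0_integral_bigcup//; last 2 first.
  - exact/measurable_EFinP/measurable_funTS.
  - by move=> x _; rewrite lee_fin.
by apply: is_cvg_ereal_nneg_natsum_cond => n _ _; exact: dens_ge0.
Qed.

HB.instance Definition _ := isMeasure.Build _ _ _ dens
  dens0 dens_ge0 dens_sigma_additive.

Import HBNNSimple.

Let integral_dens_nnsfun (h : {nnsfun T >-> R}) :
  \int[dens]_x (h x)%:E = \int[mu]_x ((f x)%:E * (h x)%:E).
Proof.
under [LHS]eq_integral do rewrite fimfunE -fsumEFin//.
rewrite ge0_integral_fsum//; last 2 first.
  - by move=> r; exact/measurable_EFinP/measurable_funM.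
  - by move=> r x _; rewrite EFinM nnfun_muleindic_ge0.
under [RHS]eq_integral => x _.
  rewrite fimfunE -fsumEFin// ge0_mule_fsumr; last first.
    by move=> r; rewrite EFinM nnfun_muleindic_ge0.
  over.
rewrite ge0_integral_fsum//; last 2 first.
  - move=> r; apply: emeasurable_funM; first exact/measurable_EFinP.
    exact/measurable_EFinP/measurable_funM.
  - by move=> r x _; rewrite mule_ge0 ?lee_fin// -lee_fin EFinM nnfun_muleindic_ge0.
apply: eq_fsbigr => r _; rewrite integralZl_indic_nnsfun// integral_indic//.
rewrite setIT /= /dens.
under [RHS]eq_integral do rewrite EFinM muleCA.
(* A negative level [r] has empty preimage under the nonnegative [h], so both sides vanish;
   otherwise the constant [r] comes out of the integral. *)
have [r0|r0] := leP 0%R r.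
  rewrite ge0_integralZl//; last 2 first.
    apply: emeasurable_funM; first exact/measurable_EFinP.
    exact/measurable_EFinP/measurable_indic.
    by move=> x _; rewrite mule_ge0// lee_fin.
  congr (_ * _); rewrite integral_mkcond; apply: eq_integral => x _.
  by rewrite patchE indicE; case: ifPn; rewrite ?mule1 ?mule0.
rewrite preimage_nnfun0// integral_set0 mule0.
by rewrite integral0_eq// => x _; rewrite indicE in_set0 !mule0.
Qed.

(** The formula holds for nonnegative simple functions by linearity and passes to increasing limits
    by monotone convergence on both sides. *)
Lemma ex_density_measure : exists nu : {measure set T -> \bar R},
  forall h : T -> \bar R, measurable_fun [set: T] h -> (forall x, 0 <= h x) ->
    \int[nu]_x h x = \int[mu]_x ((f x)%:E * h x).
Proof.
exists dens => h mh h0.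
pose h_ := nnsfun_approx measurableT mh.
have h_cvg x : (h_ n x)%:E @[n --> \oo] --> h x by exact: cvg_nnsfun_approx.
have h_nd x : nondecreasing_seq (fun n => (h_ n x)%:E).
  by move=> m n mn; rewrite lee_fin; exact/lefP/nd_nnsfun_approx.
have mh_ n : measurable_fun [set: T] (fun x => (h_ n x)%:E).
  exact/measurable_EFinP.
transitivity (limn (fun n => \int[dens]_x (h_ n x)%:E)).
  rewrite -monotone_convergence//.
  - by apply: eq_integral => x _; exact/esym/cvg_lim.
  - by move=> n x _; rewrite lee_fin.
transitivity (limn (fun n => \int[mu]_x ((f x)%:E * (h_ n x)%:E))).
  by congr (limn _); apply/funext => n; exact: integral_dens_nnsfun.
rewrite -monotone_convergence//.
- apply: eq_integral => x _; apply/cvg_lim => //.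
  exact: cvgeZl.
- by move=> n; apply: emeasurable_funM => //; exact/measurable_EFinP.
- by move=> n x _; rewrite mule_ge0// lee_fin.
- by move=> x _ m n mn; rewrite lee_wpmul2l ?lee_fin//; exact: h_nd.
Qed.

End density_measure.

(** Push forward by [g] the measure whose density is [f] extended by 0 off [D]; this extension is
    why the sign of [f] matters on [D] only. Every piece of the coupling is of this kind. *)
Lemma ex_weighted_image (d1 d2 : measure_display) (T1 : measurableType d1)
    (T2 : measurableType d2) (R : realType) (mu : {measure set T1 -> \bar R})
    (D : set T1) (f : T1 -> R) (g : T1 -> T2) :
  measurable D -> measurable_fun D f -> (forall x, D x -> 0 <= f x) ->
  measurable_fun [set: T1] g ->
  (exists nu : {measure set T2 -> \bar R},
    forall h : T2 -> \bar R, measurable_fun [set: T2] h ->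
      (forall x, 0 <= h x) ->
      \int[nu]_y h y = \int[mu]_(x in D) ((f x)%:E * h (g x)))%E.
Proof.
move=> mD mf f0 mg.
have mfD : measurable_fun [set: T1] (f \_ D).
  exact/(measurable_restrictT _ _).1.
have fD0 x : 0 <= (f \_ D) x by rewrite patchE; case: ifPn => // /set_mem/f0.
have [nu nuE] := @ex_density_measure _ _ _ mu _ mfD fD0.
unshelve (exists (pushforward nu g)); first exact: mg.
move=> h mh h0.
rewrite ge0_integral_pushforward// preimage_setT nuE//=.
  rewrite [RHS]integral_mkcond; apply: eq_integral => x _.
  by rewrite !patchE; case: ifPn; rewrite ?mul0e.
exact: measurableT_comp.
Qed.

(** * Quantile functions *)

(** Closed left half-lines are stable under intersection, generate the Borel sets and exhaust the
    line along the integers, so the uniqueness theorem for measures applies. *)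
Lemma eq_measure_itvNyc (R : realType) (m1 m2 : {measure set R -> \bar R}) :
  (forall x : R, m1 `]-oo, x]%classic < +oo)%E ->
  (forall x : R, m1 `]-oo, x]%classic = m2 `]-oo, x]%classic) ->
  forall A, measurable A -> m1 A = m2 A.
Proof.
move=> m1oo m12 A mA.
pose G := [set A : set R | exists x, A = `]-oo, x]%classic].
apply: (measure_unique G (fun n => `]-oo, n%:R]%classic)) => //.
- rewrite eqEsubset; split => B.
    rewrite [measurable](RGenOInfty.measurableE R).
    apply: smallest_sub; first exact: smallest_sigma_algebra.
    move=> _ [x ->]; rewrite -setCitvl.
    have [_ GC _] := smallest_sigma_algebra [set: R] G.
    by rewrite -setTD; apply: GC; apply: sub_sigma_algebra; exists x.
  apply: smallest_sub; first exact: sigma_algebra_measurable.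
  by move=> _ [x ->]; exact: measurable_itv.
- move=> _ _ [x ->] [y ->]; exists (Num.min x y).
  by apply/seteqP; split => z /=; rewrite !in_itv/= le_min => /andP.
- by move=> n; exists n%:R.
- rewrite -subTset => x _; exists (Num.truncn x).+1 => //=.
  by rewrite in_itv/= ltW// truncnS_gt.
- by move=> _ [x ->].
Qed.

Section quantile.
Variables (R : realType) (m : {measure set R -> \bar R}) (M : R).
Hypothesis mM : m [set: R] = M%:E.

Local Lemma measure_fin_num A : measurable A -> m A \is a fin_num.
Proof.
move=> mA; rewrite ge0_fin_numE//; apply: (@le_lt_trans _ _ M%:E).
  by rewrite -mM le_measure// ?inE.
exact: ltry.
Qed.

Local Lemma le_cdf x y : x <= y -> (m `]-oo, x]%classic <= m `]-oo, y]%classic)%E.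
Proof. by move=> xy; rewrite le_measure ?inE//; exact: subitvPr. Qed.

(** Continuity from below: the masses of []-oo, n]] tend to [M]. This makes the set defining the
    quantile nonempty. *)
Local Lemma ex_cdf_ge s : s < M -> exists x, (s%:E <= m `]-oo, x]%classic)%E.
Proof.
move=> sM; apply: contrapT => /forallNP H.
have : m `]-oo, n%:R]%classic @[n --> \oo] --> m [set: R].
  have <- : \bigcup_n `]-oo, n%:R]%classic = [set: R].
    rewrite -subTset => t /= _; exists (Num.truncn t).+1 => //=.
    by rewrite in_itv/= ltW// truncnS_gt.
  apply: nondecreasing_cvg_mu => //; first exact: bigcup_measurable.
  by move=> k n kn; apply/subsetPset; apply: subset_itvl; rewrite bnd_simp ler_nat.
move=> cvgM; suff : (m [set: R] <= s%:E)%E.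
  by rewrite mM lee_fin leNgt sM.
rewrite -(cvg_lim _ cvgM)//; apply: lime_le.
  by apply/cvg_ex; exists (m [set: R]).
by apply: nearW => n; have /negP := H n%:R; rewrite -ltNge => /ltW.
Qed.

(** Continuity from above: the masses of []-oo, -n]] tend to 0. This bounds the same set from
    below. *)
Local Lemma ex_cdf_lt s : 0 < s -> exists x, (m `]-oo, x]%classic < s%:E)%E.
Proof.
move=> s0; apply: contrapT => /forallNP H.
have : m `]-oo, (- n%:R)%R]%classic @[n --> \oo] --> m set0.
  have <- : \bigcap_n `]-oo, (- n%:R)%R]%classic = set0 :> set R.
    rewrite -subset0 => t /(_ (Num.truncn (- t)).+1 I).
    by rewrite /= in_itv/= leNgt => /negP; apply; rewrite ltrNl truncnS_gt.
  apply: nonincreasing_cvg_mu => //.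
  - by rewrite -ge0_fin_numE// measure_fin_num.
  - exact: bigcap_measurable.
  - by move=> k n kn; apply/subsetPset; apply: subset_itvl;
    rewrite bnd_simp lerN2 ler_nat.
rewrite measure0 => cvg0; suff : (s%:E <= 0)%E.
  by rewrite lee_fin leNgt s0.
rewrite -(cvg_lim _ cvg0)//; apply: lime_ge.
  by apply/cvg_ex; exists 0%E.
by apply: nearW => n; have /negP := H (- n%:R); rewrite -leNgt.
Qed.

(** Right continuity of the distribution function, by which the infimum in the quantile is
    attained. *)
Local Lemma cdf_ge_closed s x :
  (forall y, x < y -> (s%:E <= m `]-oo, y]%classic)%E) ->
  (s%:E <= m `]-oo, x]%classic)%E.
Proof.
move=> H; have : m `]-oo, (x + n.+1%:R^-1)%R]%classic @[n --> \oo] -->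
    m `]-oo, x]%classic.
  rewrite (itvNycEbigcap false x); apply: nonincreasing_cvg_mu => //.
  - by rewrite -ge0_fin_numE// measure_fin_num.
  - exact: bigcap_measurable.
  - move=> k n kn; apply/subsetPset; apply: subset_itvl.
    by rewrite bnd_simp lerD2l lef_pV2 ?posrE// ler_nat.
move=> cvgx; rewrite -(cvg_lim _ cvgx)//; apply: lime_ge.
  by apply/cvg_ex; exists (m `]-oo, x]%classic).
by apply: nearW => n; apply: H; rewrite ltrDl.
Qed.

(** The generalized inverse of the distribution function of [m]. It is meaningful for [0 < s < M];
    elsewhere the set may be empty or unbounded below and [inf] a default value. *)
Let q s := inf [set x | (s%:E <= m `]-oo, x]%classic)%E].

Local Lemma quantile_galois s x : 0 < s < M ->
  (q s <= x) = (s%:E <= m `]-oo, x]%classic)%E.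
Proof.
move=> /andP[s0 sM].
have [z zs] := ex_cdf_lt s s0; have [y ys] := ex_cdf_ge s sM.
have S0 : [set x | (s%:E <= m `]-oo, x]%classic)%E] !=set0 by exists y.
have Slb : has_lbound [set x | (s%:E <= m `]-oo, x]%classic)%E].
  exists z => t /= st; rewrite leNgt; apply/negP => tz.
  by have := le_lt_trans (le_trans st (le_cdf _ _ (ltW tz))) zs; rewrite ltxx.
apply/idP/idP => [qx|sx]; last exact: ge_inf.
apply: le_trans (le_cdf _ _ qx); apply: cdf_ge_closed => t qt.
have [u /= su ut] := inf_lt S0 qt.
exact: le_trans su (le_cdf _ _ (ltW ut)).
Qed.

(** By the Galois connection, the points of []0, M[] that [Q] sends into []-oo, x]] are those [s]
    with [s <= m ]-oo, x]]. Hence [m] and the image of Lebesgue measure on []0, M[] agree on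
    half-lines, so everywhere. *)
Lemma ex_quantile : exists Q : R -> R,
  [/\ measurable_fun [set: R] Q,
      forall s x, 0 < s < M -> (Q s <= x) = (s%:E <= m `]-oo, x]%classic)%E &
      forall h : R -> \bar R, measurable_fun [set: R] h ->
        (forall x, 0 <= h x)%E ->
        (\int[m]_x h x = \int[lebesgue_measure]_(s in `]0%R, M[) h (Q s))%E].
Proof.
pose Q := q \_ `]0, M[%classic.
have QE s : 0 < s < M -> Q s = q s.
  by move=> sM; rewrite /Q patchE mem_set//= in_itv.
have Qgalois s x : 0 < s < M -> (Q s <= x) = (s%:E <= m `]-oo, x]%classic)%E.
  by move=> sM; rewrite QE// quantile_galois.
have mQ : measurable_fun [set: R] Q.
  apply/(measurable_restrictT _ _).1 => //.
  apply: (measurability _ (RGenOInfty.measurableE R)) => //.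
  move=> _ [_ [x ->] <-].
  rewrite (_ : _ `&` _ = `]0, M[ `&` `]fine (m `]-oo, x]%classic), +oo[)%classic.
    exact: measurableI.
  apply/seteqP; split => s /=; rewrite !in_itv/= !andbT => -[sM] sx;
    split => //; move: sx; rewrite [q _ > _]ltNge [_ < s]ltNge;
    by rewrite quantile_galois// -[s <= fine _]lee_fin fineK ?measure_fin_num.
exists Q; split => // h mh h0.
have [nu nuE] := @ex_weighted_image _ _ _ _ _ (@lebesgue_measure R)
  `]0, M[%classic (cst 1) Q ltac:(by []) ltac:(by []) ltac:(by []) mQ.
have := nuE _ mh h0; under [RHS]eq_integral do rewrite mul1e.
move=> <-; apply: eq_measure_integral => A mA _.
apply: eq_measure_itvNyc mA => x; first by rewrite -ge0_fin_numE// measure_fin_num.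
have : (\int[nu]_y (\1_`]-oo, x] y)%:E)%E = m `]-oo, x]%classic.
  rewrite nuE; last 2 first.
  - exact/measurable_EFinP/measurable_indic.
  - by move=> y; rewrite lee_fin.
  under eq_integral do rewrite mul1e.
  rewrite (_ : (fun s => _) = (fun s => (\1_(Q @^-1` `]-oo, x]) s)%:E))//.
  rewrite integral_indic//; last by rewrite -[X in measurable X]setTI; exact: mQ.
  have xM : fine (m `]-oo, x]%classic) <= M.
    by rewrite -lee_fin fineK ?measure_fin_num// -mM le_measure// ?inE.
  have -> : Q @^-1` `]-oo, x] `&` `]0, M[%classic =
      `]0, M[ `&` `]-oo, fine (m `]-oo, x]%classic)]%classic.
    apply/seteqP; split => s /=; rewrite !in_itv/= => -[].
      by move=> Qs sM; split => //; rewrite -lee_fin fineK ?measure_fin_num// -Qgalois.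
    by move=> sM; rewrite -lee_fin fineK ?measure_fin_num// -Qgalois.
  have F0 : 0 <= fine (m `]-oo, x]%classic) by rewrite fine_ge0.
  rewrite -[RHS]fineK ?measure_fin_num//; move: (fine _) xM F0 => F FM F0.
  (* The right end [F] is included unless [F = M], since [M] itself lies outside []0, M[]; the
     length is [F] in both cases. *)
  rewrite (_ : _ `&` _ = [set` Interval (BRight 0) (BSide (F == M) F)]).
    apply: (etrans (lebesgue_measure_itv _)); rewrite /= lte_fin.
    by case: ltgtP F0 => //= [_ _|<-//]; rewrite sube0.
  have [->|FMn] := eqVneq F M; apply/seteqP; split => s /=; rewrite !in_itv/=.
  - by move=> [].
  - by move=> /andP[-> sM]; rewrite sM ltW.
  - by move=> [/andP[-> _] ->].
  - have {}FM : F < M by rewrite lt_neqAle FMn.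
    by move=> /andP[-> sF]; rewrite sF (le_lt_trans sF FM).
by rewrite integral_indic// setIT.
Qed.

End quantile.

(** [U] and [V] are the quantile functions of the measures with densities [f] and [g] on [D]. The
    Galois connection turns the order of distribution functions into the opposite order of
    quantiles. *)
Lemma ex_ordered_quantiles (R : realType) (D : set R) (f g : R -> R) (M : R) :
    measurable D -> measurable_fun [set: R] f -> measurable_fun [set: R] g ->
    (forall x, 0 <= f x) -> (forall x, 0 <= g x) ->
    (\int[lebesgue_measure]_(x in D) (f x)%:E = M%:E)%E ->
    (\int[lebesgue_measure]_(x in D) (g x)%:E = M%:E)%E ->
    (forall x : R,
      \int[lebesgue_measure]_(u in D) (g u * \1_`]-oo, x] u)%:E <=
      \int[lebesgue_measure]_(u in D) (f u * \1_`]-oo, x] u)%:E)%E ->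
  exists U V : R -> R,
  [/\ measurable_fun [set: R] U /\ measurable_fun [set: R] V,
      forall s, 0 < s < M -> U s <= V s,
      forall h : R -> \bar R, measurable_fun [set: R] h ->
        (forall x, 0 <= h x)%E ->
        (\int[lebesgue_measure]_(s in `]0%R, M[) h (U s) =
         \int[lebesgue_measure]_(x in D) ((f x)%:E * h x))%E &
      forall h : R -> \bar R, measurable_fun [set: R] h ->
        (forall x, 0 <= h x)%E ->
        (\int[lebesgue_measure]_(s in `]0%R, M[) h (V s) =
         \int[lebesgue_measure]_(x in D) ((g x)%:E * h x))%E].
Proof.
move=> mD mf mg f0 g0 fM gM gf.
have key (k : R -> R) : measurable_fun [set: R] k -> (forall x, 0 <= k x) ->
    (\int[lebesgue_measure]_(x in D) (k x)%:E = M%:E)%E ->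
    exists Q : R -> R, [/\ measurable_fun [set: R] Q,
      forall s x, 0 < s < M -> (Q s <= x) = (s%:E <=
        \int[lebesgue_measure]_(u in D) (k u * \1_`]-oo, x] u)%:E)%E &
      forall h : R -> \bar R, measurable_fun [set: R] h ->
        (forall x, 0 <= h x)%E ->
        (\int[lebesgue_measure]_(s in `]0%R, M[) h (Q s) =
         \int[lebesgue_measure]_(x in D) ((k x)%:E * h x))%E].
  move=> mk k0 kM.
  have [nu nuE] := @ex_weighted_image _ _ _ _ _ (@lebesgue_measure R) D k (id : R -> R)
    mD (measurable_funTS mk) (fun x _ => k0 x) (@measurable_id _ _ _).
  have nuI (A : set R) : measurable A ->
      (nu A = \int[lebesgue_measure]_(u in D) (k u * \1_A u)%:E)%E.
    move=> mA; transitivity (\int[nu]_x (\1_A x)%:E)%E.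
      by rewrite integral_indic// setIT.
    rewrite nuE//; exact/measurable_EFinP/measurable_indic.
  have nuM : nu [set: R] = M%:E.
    by rewrite nuI// -kM; apply: eq_integral => x _; rewrite indicT mulr1.
  have [Q [mQ Qgal QE]] := ex_quantile _ _ _ nuM.
  exists Q; split=> // [s x sM|h mh h0]; first by rewrite Qgal// nuI.
  by rewrite -QE// nuE.
have [U [mU Ugal UE]] := key f mf f0 fM.
have [V [mV Vgal VE]] := key g mg g0 gM.
exists U, V; split=> // s sM; rewrite Ugal//.
by apply: le_trans (gf _); rewrite -Vgal.
Qed.

(** * Martingale coupling of two monotone functions *)

Section pos_part_theory.
Context {R : realType}.
Implicit Types x : R.

Lemma pos_part_ge0 x : 0 <= pos_part x.
Proof. by rewrite /pos_part le_max lexx. Qed.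

Lemma pos_part_ge x : x <= pos_part x.
Proof. by rewrite /pos_part le_max lexx orbT. Qed.

Lemma pos_part_id x : 0 <= x -> pos_part x = x.
Proof. by move=> x0; rewrite /pos_part; exact/max_idPr. Qed.

Lemma pos_part_eq0 x : x <= 0 -> pos_part x = 0.
Proof. by move=> x0; rewrite /pos_part; exact/max_idPl. Qed.

Lemma pos_partBN x : pos_part x - pos_part (- x) = x.
Proof.
have [x0|x0] := leP 0 x.
  by rewrite pos_part_id// pos_part_eq0 ?oppr_le0// subr0.
by rewrite pos_part_eq0 ?ltW// pos_part_id ?oppr_ge0 ?ltW// sub0r opprK.
Qed.

Lemma pos_part_le_norm x : pos_part x <= `|x|.
Proof. by rewrite /pos_part ge_max normr_ge0 ler_norm. Qed.

End pos_part_theory.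

Lemma measurable_pos_part (d : measure_display) (T : measurableType d)
    (R : realType) (D : set T) (f : T -> R) :
  measurable_fun D f -> measurable_fun D (fun x => pos_part (f x)).
Proof. by move=> mf; exact: measurable_maxr. Qed.

(** On nonnegative reals the inverse is the power with exponent -1, including at 0, where both take
    the value 0. *)
Lemma measurable_funV_ge0 (d : measure_display) (T : measurableType d)
    (R : realType) (D : set T) (f : T -> R) : (forall x, 0 <= f x) ->
  measurable_fun D f -> measurable_fun D (fun x => (f x)^-1).
Proof.
move=> f0 mf; rewrite (_ : (fun x => _) = (fun x => powR (f x) (-1))).
  exact: (measurableT_comp (measurable_powR (-1))).
by apply/funext => x; rewrite powR_inv1.
Qed.

Section increasing_rearrangements.
Variables (R : realType) (a b : R -> R).
Hypotheses (ma : measurable_fun [set: R] a) (mb : measurable_fun [set: R] b).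
Hypothesis nda : forall s t, 0 < s < 1 -> 0 < t < 1 -> s <= t -> a s <= a t.
Hypothesis ndb : forall s t, 0 < s < 1 -> 0 < t < 1 -> s <= t -> b s <= b t.
Let I := `]0%R, 1%R[%classic : set R.
Let mu := @lebesgue_measure R.
Hypotheses (inta : mu.-integrable I (EFin \o a)).
Hypotheses (intb : mu.-integrable I (EFin \o b)).
Hypothesis ab_mean : (\int[mu]_(u in I) (a u)%:E = \int[mu]_(u in I) (b u)%:E)%E.
Hypothesis ab_order : forall y, (\int[mu]_(u in I) (pos_part (y - a u))%:E <=
  \int[mu]_(u in I) (pos_part (y - b u))%:E)%E.

Let Dp u := pos_part (a u - b u).
Let Dm u := pos_part (b u - a u).

Local Lemma mDp : measurable_fun [set: R] Dp.
Proof. by apply: measurable_pos_part; exact: measurable_funB. Qed.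

Local Lemma mDm : measurable_fun [set: R] Dm.
Proof. by apply: measurable_pos_part; exact: measurable_funB. Qed.

Local Lemma mI : @measurable _ (measurableTypeR R) I. Proof. exact: measurable_itv. Qed.

Local Lemma muI : mu I = 1%E.
Proof.
apply: (etrans (lebesgue_measure_itv _)).
by rewrite /= lte_fin ltr01 oppr0 adde0.
Qed.

Local Lemma DpBDm u : Dp u - Dm u = a u - b u.
Proof. by rewrite /Dp /Dm -[b u - a u]opprB pos_partBN. Qed.

Local Lemma pos_part_integrable (f : R -> R) :
  mu.-integrable I (EFin \o f) ->
  mu.-integrable I (EFin \o (fun u => pos_part (f u))).
Proof.
move=> intf; apply: (le_integrable _ _ _ intf) => //; first exact: mI.
  apply/measurable_EFinP/measurable_pos_part/measurable_EFinP.
  exact: measurable_int intf.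
move=> u _ /=; rewrite lee_fin [leLHS]ger0_norm ?pos_part_ge0//.
exact: pos_part_le_norm.
Qed.

Local Lemma cst_integrable y : mu.-integrable I (EFin \o cst y).
Proof.
apply: measurable_bounded_integrable => //.
- exact: mI.
- by apply: (le_lt_trans _ (ltry 1)); have /eqP := muI; rewrite eq_le => /andP[].
- by exists `|y|; split => // z yz u _ /=; exact: ltW.
Qed.

Local Lemma intDp : mu.-integrable I (EFin \o Dp).
Proof. by apply: pos_part_integrable; exact: (integrableB mI inta intb). Qed.

Local Lemma intDm : mu.-integrable I (EFin \o Dm).
Proof. by apply: pos_part_integrable; exact: (integrableB mI intb inta). Qed.

(** Integrate [Dm + a = Dp + b] and cancel the common finite mean of [a] and [b]. *)
Local Lemma integral_Dp_Dm :
  (\int[mu]_(u in I) (Dm u)%:E = \int[mu]_(u in I) (Dp u)%:E)%E.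
Proof.
have : (\int[mu]_(u in I) ((Dm u)%:E + (a u)%:E) =
        \int[mu]_(u in I) ((Dp u)%:E + (b u)%:E))%E.
  apply: eq_integral => u _; rewrite -!EFinD; congr EFin.
  by have := DpBDm u; lra.
rewrite !integralD//; [|exact: mI| exact: intDp |exact: mI|exact: intDm].
rewrite ab_mean => E; have fb := integrable_fin_num mI intb.
by rewrite -[LHS](addeK _ fb) E addeK.
Qed.

(* The second-order dominance hypothesis at level y = b x: monotonicity of [b]
   makes (b x - b u)^+ vanish beyond x, which localises it to (0, x]. *)
Local Lemma Dm_le_Dp x :
  (\int[mu]_(u in I) (Dm u * \1_`]-oo, x] u)%:E <=
   \int[mu]_(u in I) (Dp u * \1_`]-oo, x] u)%:E)%E.
Proof.
(* For [x <= 0] both integrals vanish; for [x >= 1] the indicator is 1 on [I] and the two masses are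
   equal. *)
have [x0|x0] := leP x 0.
  rewrite !integral0_eq// => u; rewrite /I /= in_itv/= => /andP[u0 _];
  rewrite indicE memNset ?mulr0//= in_itv/=; apply/negP;
  by rewrite -ltNge (le_lt_trans x0).
have [x1|x1] := leP 1 x.
  have E (f : R -> R) : (\int[mu]_(u in I) (f u * \1_`]-oo, x] u)%:E =
      \int[mu]_(u in I) (f u)%:E)%E.
    apply: eq_integral => u; rewrite /I inE/= in_itv/= => /andP[_ u1].
    by rewrite indicE mem_set ?mulr1//= in_itv/= (le_trans (ltW u1)).
  by rewrite !E integral_Dp_Dm.
set J : R -> R := \1_`]-oo, x].
have mJ : measurable_fun [set: R] J by exact: measurable_indic.
have xI : 0 < x < 1 by rewrite x0.
(* This finite quantity is added to both sides. On the right [ab_order] lets it be replaced by the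
   integral of [(b x - a u)^+], after which the inequality holds pointwise: for [u <= x] because
   [Dm - b = Dp - a], beyond [x] because [(b x - b u)^+ = 0]. *)
set Pb := (\int[mu]_(u in I) (pos_part (b x - b u))%:E)%E.
have Pbfin : Pb \is a fin_num.
  apply: (integrable_fin_num mI (pos_part_integrable (fun u => b x - b u) _)).
  exact: (integrableB mI (cst_integrable _) intb).
rewrite -(leeD2rE _ _ Pbfin).
apply: (@le_trans _ _ (\int[mu]_(u in I) (Dp u * J u)%:E +
   \int[mu]_(u in I) (pos_part (b x - a u))%:E)%E); last exact: leeD2l.
have mP (c : R -> R) : measurable_fun [set: R] c ->
    measurable_fun I (fun u => (pos_part (b x - c u))%:E).
  move=> mc; apply/measurable_EFinP/measurable_funTS/measurable_pos_part.
  exact: measurable_funB.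
have mD (f : R -> R) : measurable_fun [set: R] f ->
    measurable_fun I (fun u => (f u * J u)%:E).
  by move=> mf; apply/measurable_EFinP/measurable_funTS/measurable_funM.
have P0 (c : R -> R) u : I u -> (0 <= (pos_part (b x - c u))%:E)%E.
  by move=> _; rewrite lee_fin pos_part_ge0.
have D0 (f : R -> R) u : I u -> (0 <= (pos_part (f u) * J u)%:E)%E.
  by move=> _; rewrite lee_fin mulr_ge0// pos_part_ge0.
rewrite -!ge0_integralD//; do ?[exact: mI|exact: D0|exact: P0|exact: mP];
  do ?[apply: mD; exact: mDm | apply: mD; exact: mDp].
apply: ge0_le_integral; first exact: mI.
- by move=> u Iu; exact: (adde_ge0 (D0 (fun u => b u - a u) _ Iu) (P0 b _ Iu)).
- by apply: emeasurable_funD; [apply: mD; exact: mDm|exact: mP].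
- by apply: emeasurable_funD; [apply: mD; exact: mDp|exact: mP].
move=> u; rewrite /I /= in_itv/= => uI; rewrite -!EFinD lee_fin /J indicE.
have [ux|xu] := leP u x.
  rewrite mem_set/= ?in_itv//= !mulr1 [pos_part (b x - b u)]pos_part_id.
    have := DpBDm u; have := pos_part_ge (b x - a u); lra.
  by rewrite subr_ge0 ndb.
rewrite memNset/=; last by rewrite in_itv/=; apply/negP; rewrite -ltNge.
rewrite !mulr0 !add0r pos_part_eq0 ?pos_part_ge0//.
by rewrite subr_le0 ndb// ltW.
Qed.


Local Lemma integral_Dp_EFin : exists M : R,
  (\int[mu]_(u in I) (Dp u)%:E = M%:E)%E.
Proof.
have /fineK <- := integrable_fin_num mI intDp.
by exists (fine (\int[mu]_(u in I) (EFin \o Dp) u)).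
Qed.

(** [Ip] and [Im] carry the mass to be exchanged; on [I0] the diagonal coupling already has equal
    coordinates. *)
Let Ip := I `&` [set u | b u < a u].
Let Im := I `&` [set u | a u < b u].
Let I0 := I `&` [set u | a u = b u].

Local Lemma measurable_setltr (f g : R -> R) : measurable_fun [set: R] f ->
  measurable_fun [set: R] g -> measurable [set u | f u < g u].
Proof.
move=> mf mg; have := measurable_fun_ltr mf mg measurableT.
by move=> /(_ [set true]); rewrite setTI; exact.
Qed.

Local Lemma mIp : measurable Ip.
Proof. by apply: measurableI; [exact: mI|exact: measurable_setltr]. Qed.

Local Lemma mIm : measurable Im.
Proof. by apply: measurableI; [exact: mI|exact: measurable_setltr]. Qed.

Local Lemma mI0 : measurable I0.
Proof.
rewrite (_ : I0 = I `\` (Ip `|` Im)).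
  apply: measurableD; first exact: mI.
  by apply: measurableU; [exact: mIp|exact: mIm].
apply/seteqP; split => u /=; rewrite /I0 /Ip /Im /=.
  by move=> [Iu ->]; rewrite ltxx; split => // -[[]|[]].
by move=> [Iu]; case: (ltgtP (a u) (b u)) => [ab []|ab []|//]; [right|left].
Qed.

(** [Dp * Dp^-1] is the indicator of [Ip], as the inverse of 0 is 0, and likewise for [Dm] and [Im].
    Keeping both factors exposes the densities that [U] and [V] transport to Lebesgue measure on
    []0, M[]. *)
Local Lemma integral_I_split (k : R -> \bar R) : measurable_fun [set: R] k ->
  (forall x, 0 <= k x)%E ->
  (\int[mu]_(u in I) k u = \int[mu]_(u in I0) k u +
     (\int[mu]_(u in I) ((Dp u)%:E * (((Dp u)^-1)%:E * k u)) +
      \int[mu]_(u in I) ((Dm u)%:E * (((Dm u)^-1)%:E * k u))))%E.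
Proof.
move=> mk k0.
have E (f : R -> R) (J : set R) : (forall u, I u -> J u -> 0 < f u) ->
    (forall u, I u -> ~ J u -> f u <= 0) ->
    (\int[mu]_(u in I) ((pos_part (f u))%:E * (((pos_part (f u))^-1)%:E * k u)) =
     \int[mu]_(u in I `&` J) k u)%E.
  move=> fJ fNJ; rewrite integral_mkcondr; apply: eq_integral => u /set_mem Iu.
  rewrite patchE; case: ifPn => [/set_mem Ju|/negP uJ].
    have f0 := fJ _ Iu Ju.
    by rewrite muleA -EFinM pos_part_id ?(ltW f0)// mulfV ?gt_eqF// mul1e.
  by rewrite pos_part_eq0 ?mul0e// fNJ// => Ju; apply: uJ; exact/mem_set.
rewrite (E (fun u => a u - b u) [set u | b u < a u]); last 2 first.
- by move=> u _; rewrite subr_gt0.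
- by move=> u _ /negP; rewrite -leNgt subr_le0.
rewrite (E (fun u => b u - a u) [set u | a u < b u]); last 2 first.
- by move=> u _; rewrite subr_gt0.
- by move=> u _ /negP; rewrite -leNgt subr_le0.
have IE : I = I0 `|` (Ip `|` Im).
  apply/seteqP; split => u /=; rewrite /I0 /Ip /Im /=; last first.
    by move=> [[]|[[]|[]]].
  by move=> Iu; case: (ltgtP (a u) (b u)) => ab; [right;right|right;left|left].
rewrite [in LHS]IE ge0_integral_setU//.
- rewrite ge0_integral_setU//; first exact: mIp.
  + exact: mIm.
  + exact: measurable_funTS.
  + apply/disj_setPS => u [[_ /= ab] [_ /= ba]].
    by have := lt_trans ab ba; rewrite ltxx.
- exact: mI0.
- by apply: measurableU; [exact: mIp|exact: mIm].
- exact: measurable_funTS.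
- apply/disj_setPS => u [[_ /= ab] [] [_ /=]]; rewrite ab ltxx//.
Qed.

(** The last clause is the martingale identity, the integral of [1_A(x.1) (x.2 - x.1)] being 0, with
    terms moved across so that both integrands are nonnegative. *)
Lemma ex_martingale_coupling : exists Gam : {measure set (R * R) -> \bar R},
  [/\ forall k : R -> \bar R, measurable_fun [set: R] k ->
        (forall x, 0 <= k x)%E ->
        (\int[Gam]_x k x.1 = \int[mu]_(u in I) k (a u))%E,
      forall k : R -> \bar R, measurable_fun [set: R] k ->
        (forall x, 0 <= k x)%E ->
        (\int[Gam]_x k x.2 = \int[mu]_(u in I) k (b u))%E &
      forall A : set R, measurable A ->
        (\int[Gam]_x (\1_A x.1 * (pos_part x.2 + pos_part (- x.1)))%:E =
         \int[Gam]_x (\1_A x.1 * (pos_part (- x.2) + pos_part x.1))%:E)%E].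
Proof.
have [M DpM] := integral_Dp_EFin.
have DmM := etrans integral_Dp_Dm DpM.
have [U [V [[mU mV] UV TU TV]]] := ex_ordered_quantiles _ _ _ _ _ mI mDp mDm
  (fun u => pos_part_ge0 _) (fun u => pos_part_ge0 _) DpM DmM Dm_le_Dp.
pose J := `]0, M[%classic : set R.
have mJ : @measurable _ (measurableTypeR R) J by exact: measurable_itv.
(* The set of full measure in [J] on which [U] and [V] take values where their densities are
   positive; the strict inequalities between [a] and [b] hold there. *)
pose G := J `&` (U @^-1` Ip `&` V @^-1` Im).
have mpre (f : R -> R) (A : set R) : measurable_fun [set: R] f ->
    measurable A -> measurable (f @^-1` A).
  by move=> mf mA; rewrite -[X in measurable X]setTI; exact: mf.
have mG : @measurable _ (measurableTypeR R) G.
  apply: measurableI => //; apply: measurableI.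
    exact: (mpre _ _ mU mIp).
  exact: (mpre _ _ mV mIm).
have GP s : G s -> [/\ b (U s) < a (U s), a (U s) <= a (V s) & a (V s) < b (V s)].
  move=> [Js [[IU baU] [IV abV]]]; split => //.
  move: Js IU IV; rewrite /J /I /= !in_itv/= => Js IU IV.
  by apply: nda => //; exact: UV.
(* The image of Lebesgue measure on [J] under [Q] has density [f], which vanishes off [K]; hence [Q]
   lands in [K] almost everywhere. *)
have nullW (f Q : R -> R) (K : set R) : measurable_fun [set: R] Q ->
    measurable K -> (forall u, I u -> ~ K u -> f u = 0) ->
    (forall h : R -> \bar R, measurable_fun [set: R] h ->
      (forall x, 0 <= h x)%E ->
      (\int[mu]_(s in J) h (Q s) = \int[mu]_(x in I) ((f x)%:E * h x))%E) ->
    mu (Q @^-1` (~` K) `&` J) = 0%E.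
  move=> mQ mK fK TQ; have mNK := measurableC mK.
  have := @integral_indic _ (measurableTypeR R) _ (@lebesgue_measure R) _ mJ _
    (mpre _ _ mQ mNK).
  move=> /esym E; apply: (etrans E) => {E}.
  rewrite (TQ (fun x => (\1_(~` K) x)%:E)); last 2 first.
  - exact/measurable_EFinP/measurable_indic.
  - by move=> x; rewrite lee_fin.
  apply: integral0_eq => u Iu; have [Ku|nKu] := pselect (K u).
    by rewrite indicE memNset ?mule0//= => /(_ Ku).
  by rewrite fK// mul0e.
have nullU : mu (U @^-1` (~` Ip) `&` J) = 0%E.
  apply: (nullW Dp _ _ mU mIp _ TU) => u Iu; rewrite /Ip /= => Nu.
  apply: pos_part_eq0; rewrite subr_le0 leNgt; apply/negP => bau.
  by apply: Nu; split.
have nullV : mu (V @^-1` (~` Im) `&` J) = 0%E.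
  apply: (nullW Dm _ _ mV mIm _ TV) => u Iu; rewrite /Im /= => Nu.
  apply: pos_part_eq0; rewrite subr_le0 leNgt; apply/negP => bau.
  by apply: Nu; split.
have null : mu (J `\` G) = 0%E.
  rewrite (_ : J `\` G = (U @^-1` (~` Ip) `&` J) `|` (V @^-1` (~` Im) `&` J)).
    apply: (etrans (measureU0 _ _ nullV)) => //.
    - apply: measurableI => //; exact: (mpre _ _ mU (measurableC mIp)).
    - apply: measurableI => //; exact: (mpre _ _ mV (measurableC mIm)).
  apply/seteqP; split => s /=; rewrite /G /=.
    move=> [Js /not_andP[//|/not_andP[]]]; [left|right]; split => //.
  by move=> [[NU Js]|[NV Js]]; split => // -[_ [? ?]].
have intG (k : R -> \bar R) : measurable_fun [set: R] k ->
    (forall x, 0 <= k x)%E ->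
    (\int[mu]_(s in G) k s = \int[mu]_(s in J) k s)%E.
  move=> mk k0; rewrite [RHS](ge0_negligible_integral _ mJ _ _ null)//.
  - by rewrite setDD setIidr//; exact: subIsetl.
  - exact: measurableD.
  - exact: measurable_funTS.
(* [al], [w] are the rates at which (U s) stays put or moves to (V s), and [be],
   [w] those at which (V s) stays put or moves to (U s). *)
pose w s := (pos_part (b (V s) - b (U s)))^-1.
pose al s := (Dp (U s))^-1 - w s.
pose be s := (Dm (V s))^-1 - w s.
have mw : measurable_fun [set: R] w.
  apply: measurable_funV_ge0 => [s|]; first exact: pos_part_ge0.
  by apply/measurable_pos_part/measurable_funB; exact: measurableT_comp.
have mDpU : measurable_fun [set: R] (fun s => (Dp (U s))^-1).
  apply: measurable_funV_ge0 => [s|]; first exact: pos_part_ge0.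
  exact: (measurableT_comp mDp mU).
have mDmV : measurable_fun [set: R] (fun s => (Dm (V s))^-1).
  apply: measurable_funV_ge0 => [s|]; first exact: pos_part_ge0.
  exact: (measurableT_comp mDm mV).
have mal : measurable_fun [set: R] al by exact: measurable_funB.
have mbe : measurable_fun [set: R] be by exact: measurable_funB.
have w0 s : 0 <= w s by rewrite invr_ge0 pos_part_ge0.
(* By [GP], [b (V s) - b (U s)] is at least [a (U s) - b (U s)] and at least [b (V s) - a (V s)], so
   [w] is at most either reciprocal. *)
have al0 s : G s -> 0 <= al s.
  move=> /GP[bau aUV abv]; rewrite subr_ge0 /w /Dp.
  rewrite (pos_part_id (b _ - b _)); last lra.
  rewrite pos_part_id; last lra.
  by rewrite lef_pV2 ?posrE; lra.
have be0 s : G s -> 0 <= be s.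
  move=> /GP[bau aUV abv]; rewrite subr_ge0 /w /Dm.
  rewrite (pos_part_id (b _ - b _)); last lra.
  rewrite pos_part_id; last lra.
  by rewrite lef_pV2 ?posrE; lra.
have mpair (c f e g : R -> R) : measurable_fun [set: R] c ->
    measurable_fun [set: R] f -> measurable_fun [set: R] e ->
    measurable_fun [set: R] g ->
    measurable_fun [set: R] (fun s => (c (f s), e (g s))).
  by move=> mc mf me mg; apply: measurable_fun_pair; exact: measurableT_comp.
pose img D := ex_weighted_image _ _ (measurableTypeR R) (R * R)%type _
  (@lebesgue_measure R) D.
(* [nu0] is the part left in place on [I0]; [nu1] to [nu4] are the moves U to U, U to V, V to V and
   V to U, with [a] read at the source and [b] at the target. *)
have [nu0 E0] := img _ (cst 1) (fun u => (a u, b u)) mI0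
  (measurable_cst _) (fun _ _ => ler01) (measurable_fun_pair ma mb).
have [nu1 E1] := img _ al (fun s => (a (U s), b (U s))) mG
  (measurable_funTS mal) al0 (mpair _ _ _ _ ma mU mb mU).
have [nu2 E2] := img _ w (fun s => (a (U s), b (V s))) mG
  (measurable_funTS mw) (fun s _ => w0 s) (mpair _ _ _ _ ma mU mb mV).
have [nu3 E3] := img _ be (fun s => (a (V s), b (V s))) mG
  (measurable_funTS mbe) be0 (mpair _ _ _ _ ma mV mb mV).
have [nu4 E4] := img _ w (fun s => (a (V s), b (U s))) mG
  (measurable_funTS mw) (fun s _ => w0 s) (mpair _ _ _ _ ma mV mb mU).
pose Gam : {measure set (R * R) -> \bar R} :=
  measure_add nu0 (measure_add (measure_add nu1 nu2) (measure_add nu3 nu4)).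
have GamE (h : R * R -> \bar R) : measurable_fun [set: R * R] h ->
    (forall x, 0 <= h x)%E ->
    (\int[Gam]_x h x = \int[mu]_(u in I0) h (a u, b u) +
      \int[mu]_(s in G) (((al s)%:E * h (a (U s), b (U s)) +
                          (w s)%:E * h (a (U s), b (V s))) +
                         ((be s)%:E * h (a (V s), b (V s)) +
                          (w s)%:E * h (a (V s), b (U s)))))%E.
  move=> mh h0.
  have mt (c : R -> R) (f g : R -> R) : measurable_fun [set: R] c ->
      measurable_fun [set: R] f -> measurable_fun [set: R] g ->
      measurable_fun G (fun s => (c s)%:E * h (a (f s), b (g s)))%E.
    move=> mc mf mg; apply: measurable_funTS; apply: emeasurable_funM.
      exact/measurable_EFinP.
    exact: (measurableT_comp mh (mpair _ _ _ _ ma mf mb mg)).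
  have t0 (c : R -> R) (f g : R -> R) : (forall s, G s -> 0 <= c s) ->
      forall s, G s -> (0 <= (c s)%:E * h (a (f s), b (g s)))%E.
    by move=> c0 s Gs; rewrite mule_ge0// lee_fin c0.
  have w0' s : G s -> 0 <= w s by [].
  rewrite !ge0_integral_measure_add// E0// E1// E2// E3// E4//.
  under eq_integral do rewrite mul1e.
  congr (_ + _)%E.
  have T1 := t0 _ U U al0; have T2 := t0 _ U V w0'.
  have T3 := t0 _ V V be0; have T4 := t0 _ V U w0'.
  have m1 := mt _ _ _ mal mU mU; have m2 := mt _ _ _ mw mU mV.
  have m3 := mt _ _ _ mbe mV mV; have m4 := mt _ _ _ mw mV mU.
  rewrite -!ge0_integralD//.
  - by move=> s Gs; rewrite adde_ge0 ?T1 ?T2.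
  - exact: emeasurable_funD.
  - by move=> s Gs; rewrite adde_ge0 ?T3 ?T4.
  - exact: emeasurable_funD.
(* Since [al + w = 1 / Dp U] and [be + w = 1 / Dm V], both marginals of [Gam]
   reduce to Lebesgue measure on (0, 1); the second because the moves U -> V and
   V -> U have the same rate. *)
have regroup (k : R -> \bar R) : measurable_fun [set: R] k ->
    (forall x, 0 <= k x)%E ->
    (\int[mu]_(u in I) k u = \int[mu]_(u in I0) k u +
      \int[mu]_(s in G) (((Dp (U s))^-1)%:E * k (U s) +
                         ((Dm (V s))^-1)%:E * k (V s)))%E.
  move=> mk k0; rewrite (integral_I_split _ mk k0); congr (_ + _)%E.
  have V0 (f : R -> R) s : (0 <= ((pos_part (f s))^-1)%:E * k s)%E.
    by rewrite mule_ge0// lee_fin invr_ge0 pos_part_ge0.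
  have mVk (f : R -> R) : measurable_fun [set: R] f ->
      measurable_fun [set: R] (fun s => ((pos_part (f s))^-1)%:E * k s)%E.
    move=> mf; apply: emeasurable_funM => //; apply/measurable_EFinP.
    apply: measurable_funV_ge0 => [s|]; first exact: pos_part_ge0.
    exact: measurable_pos_part.
  have mp := mVk _ (measurable_funB ma mb).
  have mm := mVk _ (measurable_funB mb ma).
  rewrite -(TU _ mp (V0 _)) -(TV _ mm (V0 _)) -!intG//.
  - rewrite ge0_integralD//.
    + by move=> s _; exact: (V0 (fun u => a u - b u) (U s)).
    + by apply: measurable_funTS; exact: (measurableT_comp mp mU).
    + by move=> s _; exact: (V0 (fun u => b u - a u) (V s)).
    + by apply: measurable_funTS; exact: (measurableT_comp mm mV).
  - exact: (measurableT_comp mm mV).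
  - exact: (measurableT_comp mp mU).
have alE s : al s + w s = (Dp (U s))^-1 by rewrite subrK.
have beE s : be s + w s = (Dm (V s))^-1 by rewrite subrK.
exists Gam; split.
- move=> k mk k0.
  have mk1 : measurable_fun [set: R * R] (fun x : R * R => k x.1).
    exact: (measurableT_comp mk measurable_fst).
  rewrite (GamE _ mk1 (fun x => k0 x.1)).
  rewrite (regroup (k \o a) (measurableT_comp mk ma) (fun u => k0 (a u))).
  congr (_ + _)%E; apply: eq_integral => s /set_mem Gs /=.
  by rewrite -!ge0_muleDl ?lee_fin ?al0 ?be0 ?w0// -!EFinD alE beE.
- move=> k mk k0.
  have mk2 : measurable_fun [set: R * R] (fun x : R * R => k x.2).
    exact: (measurableT_comp mk measurable_snd).
  rewrite (GamE _ mk2 (fun x => k0 x.2)).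
  rewrite (regroup (k \o b) (measurableT_comp mk mb) (fun u => k0 (b u))).
  congr (_ + _)%E; apply: eq_integral => s /set_mem Gs /=.
  (* The two terms of rate [w] trade places, which regroups the four moves by target instead of
     source. *)
  rewrite [X in (_ + X)%E]addeC addeACA [X in (_ + X)%E]addeC.
  by rewrite -!ge0_muleDl ?lee_fin ?al0 ?be0 ?w0// -!EFinD alE beE.
- move=> A mA.
  have mi : measurable_fun [set: R * R] (fun x : R * R => \1_A x.1 : R).
    have mA1 : measurable_fun [set: R] (\1_A : R -> R) by exact: measurable_indic.
    exact: (measurableT_comp mA1 measurable_fst).
  have mh (f g : R * R -> R) : measurable_fun [set: R * R] f ->
      measurable_fun [set: R * R] g -> measurable_fun [set: R * R]
      (fun x : R * R => (\1_A x.1 * (pos_part (f x) + pos_part (g x)))%:E).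
    move=> mf mg; apply/measurable_EFinP/measurable_funM => //.
    by apply: measurable_funD; exact: measurable_pos_part.
  have h0 (f g : R * R -> R) x :
      (0 <= (\1_A x.1 * (pos_part (f x) + pos_part (g x)))%:E)%E.
    by rewrite lee_fin mulr_ge0// addr_ge0 ?pos_part_ge0.
  have mN (f : R * R -> R) : measurable_fun [set: R * R] f ->
      measurable_fun [set: R * R] (fun x => - f x).
    by move=> mf; exact: measurableT_comp.
  have m1 : measurable_fun [set: R * R] (fun x : R * R => x.1) by exact: measurable_fst.
  have m2 : measurable_fun [set: R * R] (fun x : R * R => x.2) by exact: measurable_snd.
  rewrite (GamE _ (mh _ _ m2 (mN _ m1)) (h0 snd (fun x => - x.1))).
  rewrite (GamE _ (mh _ _ (mN _ m2) m1) (h0 (fun x => - x.2) fst)).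
  congr (_ + _)%E; apply: eq_integral => s /set_mem.
    by move=> [_ /= ->]; rewrite [pos_part _ + _]addrC.
  move=> Gs /=; have [bau aUV abv] := GP _ Gs.
  rewrite -!EFinM -!EFinD; congr EFin; apply/eqP; rewrite -subr_eq0; apply/eqP.
  (* The drift must vanish at each source separately, since [A] may contain only one of [a (U s)]
     and [a (V s)]. Here the first term is [-1 + (a(U) - b(U)) / (b(V) - b(U))] and the second is
     [(b(V) - a(U)) / (b(V) - b(U))]. *)
  have eU : al s * (b (U s) - a (U s)) + w s * (b (V s) - a (U s)) = 0.
    rewrite /al /w /Dp pos_part_id; last lra.
    rewrite pos_part_id; last lra.
    by field; apply/andP; split; apply/eqP; lra.
  have eV : be s * (b (V s) - a (V s)) + w s * (b (U s) - a (V s)) = 0.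
    rewrite /be /w /Dm pos_part_id; last lra.
    rewrite pos_part_id; last lra.
    by field; apply/andP; split; apply/eqP; lra.
  move: eU eV (pos_partBN (a (U s))) (pos_partBN (b (U s))).
  move: (pos_partBN (a (V s))) (pos_partBN (b (V s))).
  (* With indicators and positive parts made opaque, the difference of the two sides is the
     combination of [eU] and [eV] whose coefficients are the two indicators. *)
  move: (\1_A _) (\1_A _) (pos_part _) (pos_part _) (pos_part _) (pos_part _)
    (pos_part _) (pos_part _) (pos_part _) (pos_part _).
  move=> i j p1 p2 p3 p4 p5 p6 p7 p8 <- <- eU eV e1 e2.
  rewrite -e1 -e2 in eU eV.
  rewrite -[RHS](mulr0 j) -eU -[LHS]subr0 -[X in _ - X = _](mulr0 i) -eV.
  by ring.
Qed.

End increasing_rearrangements.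

(** * Laws of random variables *)

(** Equality of laws is given through nonnegative test functions; the positive and negative parts of
    the identity are two of them. *)
Lemma eq_integral_image (R : realType) (d1 d2 : measure_display)
    (T1 : measurableType d1) (T2 : measurableType d2)
    (m1 : {measure set T1 -> \bar R}) (m2 : {measure set T2 -> \bar R})
    (D1 : set T1) (D2 : set T2) (X1 : T1 -> R) (X2 : T2 -> R) :
  (forall h : R -> \bar R, measurable_fun [set: R] h -> (forall x, 0 <= h x)%E ->
    (\int[m1]_(x in D1) h (X1 x) = \int[m2]_(x in D2) h (X2 x))%E) ->
  (\int[m1]_(x in D1) (X1 x)%:E = \int[m2]_(x in D2) (X2 x)%:E)%E.
Proof.
move=> H; rewrite integralE [RHS]integralE.
have mE : measurable_fun [set: R] (@EFin R) by exact: EFin_measurable.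
have Hp := H _ (measurable_funepos mE) (funepos_ge0 _).
have Hn := H _ (measurable_funeneg mE) (funeneg_ge0 _).
congr (_ - _)%E; [move: Hp|move: Hn];
  under eq_integral do rewrite ?funeposE ?funenegE;
  under [X in _ = X]eq_integral do rewrite ?funeposE ?funenegE;
  by move=> E; under eq_integral do rewrite ?funeposE ?funenegE;
     under [RHS]eq_integral do rewrite ?funeposE ?funenegE.
Qed.

Lemma integrable_image (R : realType) (d1 d2 : measure_display)
    (T1 : measurableType d1) (T2 : measurableType d2)
    (m1 : {measure set T1 -> \bar R}) (m2 : {measure set T2 -> \bar R})
    (D1 : set T1) (D2 : set T2) (X1 : T1 -> R) (X2 : T2 -> R) :
  measurable_fun D1 X1 ->
  (forall h : R -> \bar R, measurable_fun [set: R] h -> (forall x, 0 <= h x)%E ->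
    (\int[m1]_(x in D1) h (X1 x) = \int[m2]_(x in D2) h (X2 x))%E) ->
  m2.-integrable D2 (EFin \o X2) -> m1.-integrable D1 (EFin \o X1).
Proof.
move=> mX1 H /integrableP[_ iX2]; apply/integrableP; split.
  exact/measurable_EFinP.
have mabs : measurable_fun [set: R] (fun x : R => `|x|%:E).
  by apply/measurable_EFinP; exact: normr_measurable.
by rewrite (H (fun x => `|x|%:E)).
Qed.

Section law_of_random_variable.
Context (R : realType) (d : measure_display) (T : measurableType d).
Context (P : probability T R) (Y : {RV P >-> R}).
Hypothesis hY : ('E_P[fun w => `|Y w|%R] < +oo)%E.
Let mu := @lebesgue_measure R.

Local Lemma measurable_RV : measurable_fun [set: T] Y.
Proof. exact: measurable_funPT. Qed.

Lemma RV_integrable : P.-integrable [set: T] (EFin \o Y).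
Proof.
apply/integrableP; split; first exact/measurable_EFinP/measurable_RV.
by move: hY; rewrite unlock.
Qed.

Lemma pos_part_RV_integrable y :
  P.-integrable [set: T] (EFin \o (fun w => pos_part (y - Y w))).
Proof.
have iy : P.-integrable [set: T] (EFin \o cst y).
  exact: finite_measure_integrable_cst.
apply: (le_integrable _ _ _ (integrableB _ iy RV_integrable)) => //.
  apply/measurable_EFinP/measurable_pos_part/measurable_funB => //.
move=> w _ /=; rewrite lee_fin [leLHS]ger0_norm ?pos_part_ge0//.
exact: pos_part_le_norm.
Qed.

(** Tonelli on the region [Y w <= t <= y]: the section at [t <= y] has probability [cdf Y t], and
    the section at [w] is an interval of length [(y - Y w)^+]. *)
Lemma integral_cdf (y : R) :
  (\int[mu]_(t in `]-oo, y]) cdf Y t = \int[P]_w (pos_part (y - Y w))%:E)%E.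
Proof.
pose E : set (T * measurableTypeR R) := [set p | Y p.1 <= p.2 /\ p.2 <= y].
have mE : measurable E.
  have mY1 : measurable_fun [set: T * measurableTypeR R]
      (fun p : T * measurableTypeR R => Y p.1 : R).
    exact: (measurableT_comp measurable_RV measurable_fst).
  have mt : measurable_fun [set: T * measurableTypeR R]
      (fun p : T * measurableTypeR R => p.2 : R).
    exact: measurable_snd.
  have le_meas (f g : T * measurableTypeR R -> R) :
      measurable_fun [set: T * measurableTypeR R] f ->
      measurable_fun [set: T * measurableTypeR R] g ->
      measurable [set p | f p <= g p].
    move=> mf mg; have := measurable_fun_ler mf mg measurableT.
    by move=> /(_ [set true]); rewrite setTI; exact.
  by apply: measurableI; apply: le_meas => //; exact: measurable_cst.
transitivity (\int[mu]_t \int[P]_w (\1_E (w, t))%:E)%E.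
  rewrite integral_mkcond; apply: eq_integral => t _; rewrite patchE.
  case: ifPn => [/set_mem|/negP nty] /=.
    rewrite in_itv/= => ty; rewrite /cdf /distribution /pushforward.
    have mYt : measurable (Y @^-1` `]-oo, t]) by exact: measurable_funPTI.
    rewrite -[X in P X]setIT -integral_indic//.
    apply: eq_integral => w _; congr EFin; rewrite !indicE; congr (_%:R).
    apply: congr1; apply/idP/idP => /set_mem /=.
      by rewrite in_itv/= => Yt; apply/mem_set.
    by move=> [/= Yt _]; apply/mem_set; rewrite /= in_itv.
  rewrite integral0_eq// => w _; rewrite indicE memNset//= => -[_ /= ty].
  by apply: nty; apply/mem_set; rewrite /= in_itv.
have mE1 : measurable_fun [set: T * measurableTypeR R] (fun p => (\1_E p : R)%:E).
  exact/measurable_EFinP/measurable_indic.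
have E0 p : (0 <= (\1_E p : R)%:E)%E by rewrite lee_fin.
apply: (etrans (esym (@fubini_tonelli _ _ _ _ _ P (@lebesgue_measure R) _ mE1 E0))).
apply: eq_integral => w _.
  rewrite (_ : (fun t => _) = (fun t => (\1_(`[Y w, y]%classic : set R) t)%:E)).
    have mi : @measurable _ (measurableTypeR R) (`[Y w, y]%classic : set R).
      exact: measurable_itv.
    rewrite integral_indic// setIT.
    apply: (etrans (lebesgue_measure_itv _)); rewrite /= lte_fin.
    case: ltP => [Yy|yY]; first by rewrite -EFinB pos_part_id// subr_ge0 ltW.
    by rewrite pos_part_eq0// subr_le0.
  apply/funext => t; congr EFin; rewrite !indicE; congr (_%:R).
  apply: congr1; apply/idP/idP => /set_mem /=.
    by move=> [/= Yt ty]; apply/mem_set; rewrite /= in_itv/= Yt ty.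
  by rewrite in_itv/= => /andP[Yt ty]; apply/mem_set.
Qed.

Lemma ex_quantile_RV : exists b : R -> R,
  [/\ measurable_fun [set: R] b,
      forall s t, 0 < s < 1 -> 0 < t < 1 -> s <= t -> b s <= b t &
      forall h : R -> \bar R, measurable_fun [set: R] h ->
        (forall x, 0 <= h x)%E ->
        (\int[P]_w h (Y w) = \int[mu]_(u in `]0%R, 1%R[) h (b u))%E].
Proof.
have P1 : distribution P Y [set: R] = 1%:E by exact: probability_setT.
have [b [mb bgal bE]] := ex_quantile _ _ _ P1.
exists b; split => // [s t s01 t01 st|h mh h0].
  by rewrite bgal// (@le_trans _ _ t%:E) ?lee_fin// -bgal.
by rewrite -bE// ge0_integral_distribution.
Qed.

End law_of_random_variable.

(** * The order conditions as comparisons of the means of [(y - Y)^+] and [(y - psi)^+] *)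

Section order_of_random_variables.
Context (R : realType) (d : measure_display) (T : measurableType d).
Context (P : probability T R) (Y psi : {RV P >-> R}).
Hypothesis hY : ('E_P[fun w => `|Y w|%R] < +oo)%E.
Hypothesis hpsi : ('E_P[fun w => `|psi w|%R] < +oo)%E.
Let mu := @lebesgue_measure R.

Lemma expectation_pos_partB_ge0 y :
  (0 <= 'E_P[fun w => (pos_part (y - Y w) - pos_part (y - psi w))%R])%E =
  (\int[P]_w (pos_part (y - psi w))%:E <= \int[P]_w (pos_part (y - Y w))%:E)%E.
Proof.
have iY := pos_part_RV_integrable _ _ _ _ _ hY y.
have ipsi := pos_part_RV_integrable _ _ _ _ _ hpsi y.
rewrite unlock; under eq_integral do rewrite EFinB.
by rewrite integralB_EFin// sube_ge0// (integrable_fin_num _ ipsi).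
Qed.

Local Lemma cdf_integrable (X : {RV P >-> R}) y :
  ('E_P[fun w => `|X w|%R] < +oo)%E -> mu.-integrable `]-oo, y] (cdf X).
Proof.
move=> hX; apply/integrableP; split.
  by apply: measurable_funTS; exact: cdf_measurable.
under eq_integral do rewrite gee0_abs//.
rewrite integral_cdf.
have := integrable_fin_num measurableT (pos_part_RV_integrable _ _ _ _ _ hX y).
rewrite ge0_fin_numE//.
by apply: integral_ge0 => w _; rewrite lee_fin pos_part_ge0.
Qed.

(** Each distribution function is integrable on []-oo, y]] by Tonelli's identity, so the integral of
    the difference splits. *)
Lemma DeltaE y :
  (Delta Y psi y = \int[P]_w (pos_part (y - Y w))%:E -
                   \int[P]_w (pos_part (y - psi w))%:E)%E.
Proof.
rewrite /Delta (integralB _ (cdf_integrable _ _ hY) (cdf_integrable _ _ hpsi))//.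
by rewrite -!integral_cdf.
Qed.

Lemma Delta_ge0 y : (0 <= Delta Y psi y)%E =
  (0 <= 'E_P[fun w => (pos_part (y - Y w) - pos_part (y - psi w))%R])%E.
Proof.
rewrite DeltaE expectation_pos_partB_ge0 sube_ge0//.
by rewrite (integrable_fin_num _ (pos_part_RV_integrable _ _ _ _ _ hpsi y)).
Qed.

End order_of_random_variables.

(** * Necessity: conditional expectation and the convex order *)

Lemma eq_in_distribution_integral (R : realType)
    (d1 : measure_display) (T1 : measurableType d1) (P1 : probability T1 R)
    (d2 : measure_display) (T2 : measurableType d2) (P2 : probability T2 R)
    (X1 : {RV P1 >-> R}) (X2 : {RV P2 >-> R}) (h : R -> \bar R) :
  eq_in_distribution X1 X2 -> measurable_fun [set: R] h ->
  (forall x, 0 <= h x)%E ->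
  (\int[P1]_w h (X1 w) = \int[P2]_w h (X2 w))%E.
Proof.
move=> X12 mh h0.
rewrite -[LHS](ge0_integral_distribution X1 mh h0).
rewrite -[RHS](ge0_integral_distribution X2 mh h0).
by apply: eq_measure_integral => A mA _; exact: X12.
Qed.

(** The event [Z < y] belongs to [G], so on it [y - Z] and [y - X] have the same integral; the
    former gives the mean of [(y - Z)^+], and the latter is at most the mean of [(y - X)^+].
    Equality of means is the case of the whole space. *)
Lemma cond_expectation_convex_order (R : realType) (d : measure_display)
    (T : measurableType d) (P : probability T R) (G : set_system T)
    (X Z : {RV P >-> R}) :
  sub_sigma_algebra_of G -> is_cond_expectation G X Z ->
  (forall y, \int[P]_w (pos_part (y - Z w))%:E <=
             \int[P]_w (pos_part (y - X w))%:E)%E /\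
  (\int[P]_w (X w)%:E = \int[P]_w (Z w)%:E)%E.
Proof.
move=> [[G0 GC _] Gm] [iX iZ ZG GE].
have GT : G [set: T] by rewrite -(setD0 [set: T]); exact: GC.
split=> [y|]; last by rewrite GE.
pose A := Z @^-1` `]-oo, y[%classic.
have GA : G A.
  apply: ZG; exists (`]-oo, y[%classic); first exact: measurable_itv.
  by rewrite setTI.
have mA := Gm _ GA.
have iy D : measurable D -> P.-integrable D (EFin \o cst y).
  exact: finite_measure_integrable_cst.
have iS (V : {RV P >-> R}) : P.-integrable [set: T] (EFin \o V) ->
    P.-integrable A (EFin \o V).
  by apply: integrableS => //; exact: measurableT.
have mpos (V : {RV P >-> R}) D :
    measurable_fun D (fun w => (pos_part (y - V w))%:E).
  apply/measurable_EFinP/measurable_funTS/measurable_pos_part.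
  exact: measurable_funB.
have -> : (\int[P]_w (pos_part (y - Z w))%:E =
           \int[P]_(w in A) ((y)%:E - (X w)%:E))%E.
  rewrite integralB_EFin//; last first.
  - exact: iS.
  - exact: iy.
  rewrite -(GE _ GA) -integralB_EFin//; last first.
  - exact: iS.
  - exact: iy.
  rewrite [RHS]integral_mkcond; apply: eq_integral => w _.
  rewrite patchE; case: ifPn => [/set_mem|/negP wA].
    by rewrite /A /= in_itv/= => Zy; rewrite pos_part_id// subr_ge0 ltW.
  rewrite pos_part_eq0// subr_le0 leNgt; apply/negP => Zy; apply: wA.
  by apply/mem_set; rewrite /A /= in_itv.
apply: (@le_trans _ _ (\int[P]_(w in A) (pos_part (y - X w))%:E)%E).
  apply: le_integral => //.
  - exact: (integrableB mA (iy _ mA) (iS _ iX)).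
  - apply: (le_integrable mA _ _ (integrableB mA (iy _ mA) (iS _ iX))).
      exact: mpos.
    move=> w _ /=; rewrite lee_fin [leLHS]ger0_norm ?pos_part_ge0//.
    exact: pos_part_le_norm.
  - by move=> w _ /=; rewrite lee_fin pos_part_ge.
apply: ge0_subset_integral => // w _.
by rewrite lee_fin pos_part_ge0.
Qed.

Lemma H0_convex_order (R : realType) (d : measure_display)
    (T : measurableType d) (P : probability T R) (Y psi : {RV P >-> R}) :
  H0 Y psi ->
  (forall y, \int[P]_w (pos_part (y - psi w))%:E <=
             \int[P]_w (pos_part (y - Y w))%:E)%E /\
  (\int[P]_w (Y w)%:E = \int[P]_w (psi w)%:E)%E.
Proof.
move=> [d' [T' [P' [Y' [psi' [I' [sI _ YY' pp' cI]]]]]]].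
have [le_pos E] := cond_expectation_convex_order _ _ _ _ _ _ _ sI cI.
have mp y : measurable_fun [set: R] (fun x : R => (pos_part (y - x))%:E).
  by apply/measurable_EFinP/measurable_pos_part/measurable_funB.
have p0 y (x : R) : (0 <= (pos_part (y - x))%:E)%E.
  by rewrite lee_fin pos_part_ge0.
split => [y|].
  rewrite -(eq_in_distribution_integral _ _ _ _ _ _ _ _ _ _ YY' (mp y) (p0 y)).
  by rewrite -(eq_in_distribution_integral _ _ _ _ _ _ _ _ _ _ pp' (mp y) (p0 y)).
transitivity (\int[P']_w (Y' w)%:E)%E.
  by apply: eq_integral_image => h mh h0;
    rewrite (eq_in_distribution_integral _ _ _ _ _ _ _ _ _ _ YY').
rewrite E; apply: eq_integral_image => h mh h0.
exact: eq_in_distribution_integral.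
Qed.

Lemma H0_of_martingale_coupling (R : realType) (d : measure_display)
    (T : measurableType d) (P : probability T R) (Y psi : {RV P >-> R})
    (Gam : {measure set (R * R) -> \bar R}) :
  P.-integrable [set: T] (EFin \o Y) -> P.-integrable [set: T] (EFin \o psi) ->
  (forall k : R -> \bar R, measurable_fun [set: R] k ->
    (forall x, 0 <= k x)%E -> (\int[Gam]_x k x.1 = \int[P]_w k (psi w))%E) ->
  (forall k : R -> \bar R, measurable_fun [set: R] k ->
    (forall x, 0 <= k x)%E -> (\int[Gam]_x k x.2 = \int[P]_w k (Y w))%E) ->
  (forall A : set R, measurable A ->
    (\int[Gam]_x (\1_A x.1 * (pos_part x.2 + pos_part (- x.1)))%:E =
     \int[Gam]_x (\1_A x.1 * (pos_part (- x.2) + pos_part x.1))%:E)%E) ->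
  H0 Y psi.
Proof.
move=> iY ipsi G1 G2 Gmart.
have mind (A : set R) : measurable A ->
    measurable_fun [set: R] (fun x => (\1_A x : R)%:E).
  by move=> mA; exact/measurable_EFinP/measurable_indic.
have ind0 (A : set R) x : (0 <= (\1_A x : R)%:E)%E by rewrite lee_fin.
have mfst : measurable_fun [set: R * R] (@fst R R) by exact: measurable_fst.
have msnd : measurable_fun [set: R * R] (@snd R R) by exact: measurable_snd.
have law (A : set R) (f : R * R -> R) (X : {RV P >-> R}) : measurable A ->
    measurable_fun [set: R * R] f ->
    (forall k : R -> \bar R, measurable_fun [set: R] k ->
      (forall x, 0 <= k x)%E -> (\int[Gam]_x k (f x) = \int[P]_w k (X w))%E) ->
    Gam (f @^-1` A) = P (X @^-1` A).
  move=> mA mf fX.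
  have mfA : measurable (f @^-1` A) by rewrite -[X in measurable X]setTI; exact: mf.
  have mXA : measurable (X @^-1` A) by exact: measurable_funPTI.
  have := fX _ (mind _ mA) (ind0 A).
  have -> : (\int[Gam]_x (\1_A (f x))%:E = \int[Gam]_x (\1_(f @^-1` A) x)%:E)%E by [].
  have -> : (\int[P]_x (\1_A (X x))%:E = \int[P]_x (\1_(X @^-1` A) x)%:E)%E by [].
  by rewrite !integral_indic// !setIT.
have Gam1 : Gam [set: R * R] = 1%:E.
  have := law setT _ _ measurableT mfst G1.
  by rewrite !preimage_setT probability_setT.
(* [Gam] is unpacked so that the probability [Q] is built on the same underlying set function, and
   facts about [Gam] apply to [Q] directly. *)
case: Gam => Gamf cGam in G1 G2 Gmart law Gam1 *.
pose Gam := Measure.Pack cGam : {measure set (R * R) -> \bar R}.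
pose Q : probability (R * R)%type R :=
  HB.pack Gamf cGam (@Measure_isProbability.Build _ _ R Gam Gam1).
pose psi' : {RV Q >-> R} := HB.pack (@fst R R) (isMeasurableFun.Build _ _ _ _ _ mfst).
pose Y' : {RV Q >-> R} := HB.pack (@snd R R) (isMeasurableFun.Build _ _ _ _ _ msnd).
have i1 := integrable_image _ _ _ _ _ Gam P _ _ fst psi mfst G1 ipsi.
have i2 := integrable_image _ _ _ _ _ Gam P _ _ snd Y msnd G2 iY.
exists _, _, Q, Y', psi', (g_sigma_algebra_preimage psi'); split => //.
- split; first exact: sigma_algebra_preimage (sigma_algebra_measurable _).
  by move=> _ [B mB <-]; exact: (mfst measurableT _ mB).
- by move=> A mA; exact: law G2.
- by move=> A mA; exact: law G1.
split => // _ [B mB <-]; rewrite setTI.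
have mD : measurable (fst @^-1` B : set (R * R)).
  by rewrite -[X in measurable X]setTI; exact: (mfst measurableT _ mB).
pose D : set (R * R) := fst @^-1` B.
have iS (f : R * R -> R) : Gam.-integrable [set: R * R] (EFin \o f) ->
    Gam.-integrable D (EFin \o f).
  by apply: integrableS => //; exact: measurableT.
have ipos (f : R * R -> R) : Gam.-integrable [set: R * R] (EFin \o f) ->
    Gam.-integrable D (EFin \o (fun x => pos_part (f x))).
  move=> iff; apply: (le_integrable mD _ _ (iS _ iff)).
    apply/measurable_EFinP/measurable_funTS/measurable_pos_part/measurable_EFinP.
    exact: measurable_int iff.
  move=> x _ /=; rewrite lee_fin [leLHS]ger0_norm ?pos_part_ge0//.
  exact: pos_part_le_norm.
have iN (f : R * R -> R) : Gam.-integrable [set: R * R] (EFin \o f) ->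
    Gam.-integrable [set: R * R] (EFin \o (fun x => - f x)).
  exact: integrableN.
pose h (x : R * R) := pos_part x.2 + pos_part (- x.1).
pose h' (x : R * R) := pos_part (- x.2) + pos_part x.1.
have ih : Gam.-integrable D (EFin \o h).
  exact: (integrableD mD (ipos _ i2) (ipos _ (iN _ i1))).
have ih' : Gam.-integrable D (EFin \o h').
  exact: (integrableD mD (ipos _ (iN _ i2)) (ipos _ i1)).
have hh' : (\int[Gam]_(x in D) (h x)%:E = \int[Gam]_(x in D) (h' x)%:E)%E.
  have indE (f : R * R -> R) : (\int[Gam]_(x in D) (f x)%:E =
      \int[Gam]_x (\1_B x.1 * f x)%:E)%E.
    rewrite integral_mkcond; apply: eq_integral => x _; rewrite patchE indicE.
    rewrite (_ : (x.1 \in B) = (x \in D)).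
      by case: ifPn => _; rewrite ?mul1r ?mul0r.
    by apply/idP/idP => /set_mem ?; exact/mem_set.
  by rewrite !indE Gmart.
(* Pointwise [x.2 + h' = x.1 + h]; [h] and [h'] have the same finite integral over [D], which
   cancels. *)
have : (\int[Gam]_(x in D) ((x.2)%:E + (h' x)%:E) =
        \int[Gam]_(x in D) ((x.1)%:E + (h x)%:E))%E.
  apply: eq_integral => x _; rewrite -!EFinD; congr EFin.
  have := pos_partBN x.1; have := pos_partBN x.2; rewrite /h /h'; lra.
rewrite !integralD//; do ?[exact: iS].
rewrite hh' => E.
have fh := integrable_fin_num mD ih'.
apply/esym.
by rewrite -[LHS](addeK _ fh) E addeK.
Qed.

Theorem theorem1 (R : realType) (d : measure_display) (T : measurableType d)
    (P : probability T R) (Y psi : {RV P >-> R})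
    (hY : ('E_P[fun w => `|Y w|%R] < +oo)%E)
    (hpsi : ('E_P[fun w => `|psi w|%R] < +oo)%E) :
  [<-> H0 Y psi;
       (forall y : R, (0 <= Delta Y psi y)%E) /\ ('E_P[Y] = 'E_P[psi])%E;
       (forall y : R,
          (0 <= 'E_P[fun w => (pos_part (y - Y w) - pos_part (y - psi w))%R])%E)
       /\ ('E_P[Y] = 'E_P[psi])%E].
Proof.
have iY := RV_integrable _ _ _ _ _ hY.
have ipsi := RV_integrable _ _ _ _ _ hpsi.
tfae.
- move=> /H0_convex_order[le_pos E]; split; last by rewrite !expectation_def.
  by move=> y; rewrite Delta_ge0// expectation_pos_partB_ge0.
- by move=> [Delta0 E]; split=> // y; rewrite -Delta_ge0.
(* The order and the equality of means pass to the quantile functions of [Y] and [psi], whose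
   monotonicity the coupling requires. *)
move=> [pos0 E].
have le_pos y :
    (\int[P]_w (pos_part (y - psi w))%:E <= \int[P]_w (pos_part (y - Y w))%:E)%E.
  by rewrite -expectation_pos_partB_ge0.
have [b [mb ndb bE]] := ex_quantile_RV _ _ _ _ Y.
have [a [ma nda aE]] := ex_quantile_RV _ _ _ _ psi.
pose mu := @lebesgue_measure R.
have ia : mu.-integrable `]0%R, 1%R[ (EFin \o a).
  apply: (integrable_image _ _ _ _ _ mu P _ _ a psi _ _ ipsi).
    exact: measurable_funTS.
  by move=> h mh h0; rewrite aE.
have ib : mu.-integrable `]0%R, 1%R[ (EFin \o b).
  apply: (integrable_image _ _ _ _ _ mu P _ _ b Y _ _ iY).
    exact: measurable_funTS.
  by move=> h mh h0; rewrite bE.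
have ab_mean : (\int[lebesgue_measure]_(u in `]0%R, 1%R[) (a u)%:E =
    \int[lebesgue_measure]_(u in `]0%R, 1%R[) (b u)%:E)%E.
  rewrite -(eq_integral_image _ _ _ _ _ _ _ _ _ _ _ aE).
  rewrite -(eq_integral_image _ _ _ _ _ _ _ _ _ _ _ bE).
  by rewrite -!expectation_def.
have ab_order y :
    (\int[lebesgue_measure]_(u in `]0%R, 1%R[) (pos_part (y - a u))%:E <=
     \int[lebesgue_measure]_(u in `]0%R, 1%R[) (pos_part (y - b u))%:E)%E.
  have mp : measurable_fun [set: R] (fun x : R => (pos_part (y - x))%:E).
    by apply/measurable_EFinP/measurable_pos_part/measurable_funB.
  have p0 (x : R) : (0 <= (pos_part (y - x))%:E)%E.
    by rewrite lee_fin pos_part_ge0.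
  by rewrite -(aE _ mp p0) -(bE _ mp p0).
have [Gam [G1 G2 Gmart]] :=
  ex_martingale_coupling _ _ _ ma mb nda ndb ia ib ab_mean ab_order.
apply: (H0_of_martingale_coupling _ _ _ _ _ _ Gam iY ipsi) => // k mk k0.
- by rewrite G1// aE.
- by rewrite G2// bE.
Qed.
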